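(* Let $P_1,\dots,P_m$ be any positive-dimensional polytopes in $\mathbb{R}^{n+1}$ in general orientation, with $m\ge n+1$, and let $P=P_1+\cdots+P_m$ be their Minkowski sum. Then the number of $s$-dimensional faces of the upper part satisfies $$f_s(P^+)=\sum_{j=0}^{n}(-1)^{n-j}\binom{m-1-j}{n-j}\sum_{S\in\binom{[m]}{j}}f_s(P_S^+),\qquad s=0,\dots,n,$$ where $P_S=\sum_{i\in S}P_i$ for any nonempty $S\subseteq[m]$ and $P_\emptyset=\{0\}$.
   Context: For a polytope $P\subseteq\mathbb{R}^{n+1}$ and a face $F$ of $P$, let $C(F,P)\subseteq\mathbb{S}^n$ be the cell of unit directions $l$ for which $F$ is exactly the set of maximizers of $\langle l,\cdot\rangle$ over $P$. The set of all such cells is the spherical complex $\mathcal{G}(P)$. The upper part $P^+$ is the collection of faces $F$ of $P$ whose cell $C(F,P)$ intersects $\mathbb{R}^n\times\mathbb{R}_{>0}$; $f_s(P^+)$ is the number of $s$-dimensional faces in $P^+$. General orientation: a polytope $P\subseteq\mathbb{R}^{n+1}$ is in general orientation if none of the great circles defined by one-dimensional cells of $\mathcal{G}(P)$ contains a standard unit vector. A family $P_1,\dots,P_m\subseteq\mathbb{R}^{n+1}$ is in general orientation if each $P_i$ is in general orientation, and for all $S\subseteq[m]$ and any $C_i\in\mathcal{G}(P_i)$, $i\in S$, the intersection $\bigcap_{i\in S}C_i$ is either empty or has codimension at least $\min\{\sum_{i\in S}\operatorname{codim}(C_i),\,n\}$ (codimensions taken in $\mathbb{S}^n$). $[m]=\{1,\dots,m\}$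 and $\binom{[m]}{j}$ is the set of $j$-element subsets of $[m]$.
   Formalization: In the definition of general orientation of a family, the bound min{sum of codim(C_i), n} is replaced by min{sum of codim(C_i), n+1}: cells whose codimensions add up to more than n must not meet. With the bound n the formula fails for three segments in R^3 along coplanar vectors. *)

(* Defs.v *)
(* MathComp, with the classical sets and real numbers of MathComp-Analysis. *)
From HB Require Import structures.
From mathcomp Require Import all_boot all_order all_algebra finmap.
From mathcomp Require Import boolp classical_sets cardinality reals.

Set Implicit Arguments.
Unset Strict Implicit.
Unset Printing Implicit Defensive.

Import Order.TTheory GRing.Theory Num.Theory.

Local Open Scope classical_set_scope.
Local Open Scope ring_scope.

Section Dimension.
Context {R : realType} {d : nat}.
Implicit Types A : set 'rV[R]_d.

Definition dot (u v : 'rV[R]_d) : R := \sum_i u 0 i * v 0 i.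

Definition conv_hull k (v : 'I_k -> 'rV[R]_d) : set 'rV[R]_d :=
  [set x | exists w : 'I_k -> R,
     [/\ forall i, 0 <= w i, \sum_i w i = 1 & x = \sum_i w i *: v i]].

Definition lin_span A : set 'rV[R]_d :=
  [set x | exists k (M : 'M[R]_(k, d)),
     (forall i, A (row i M)) /\ (x <= M)%MS].

(* The dimension of [lin_span A], as the largest size of a linearly independent
   family in [A]. *)
Definition lin_dim A : nat :=
  \max_(k < d.+1 | `[< exists M : 'M[R]_(k, d),
     (forall i, A (row i M)) /\ row_free M >]) k.

(* The dimension of the affine hull of a nonempty set (0 on the empty set). *)
Definition aff_dim A : nat :=
  lin_dim [set z | exists x y, [/\ A x, A y & z = x - y]].

End Dimension.

Section Polytopes.
Context {R : realType} {n : nat}.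
Local Notation V := 'rV[R]_n.+1.
Implicit Types (P F C : set V) (l : V).

Definition polytope P : Prop := exists k (v : 'I_k.+1 -> V), P = conv_hull v.

Definition maximizers l P : set V :=
  [set x | P x /\ forall y, P y -> dot l y <= dot l x].

(* The nonempty faces of a polytope; [l = 0] gives the polytope itself. *)
Definition face F P : Prop := exists l, F = maximizers l P.

Definition sphere : set V := [set l | dot l l = 1].

Definition cell F P : set V := [set l | sphere l /\ maximizers l P = F].

Definition sph_complex P : set (set V) :=
  [set C | exists F, face F P /\ C = cell F P].

(* Dimension and codimension in the n-sphere of a nonempty set that is the trace
   on the sphere of a convex cone, such as an intersection of cells: the cone
   has one dimension more than its trace. *)
Definition sph_dim C : nat := (lin_dim C).-1.
Definition sph_codim C : nat := (n - sph_dim C)%N.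

Definition great_circle C : set V := lin_span C `&` sphere.

Definition general_orientation1 P : Prop :=
  forall C, sph_complex P C -> sph_dim C = 1%N ->
  forall i, ~ great_circle C (delta_mx 0 i).

(* Nonempty subsets of the n-sphere have codimension at most n, so the bound
   n + 1 says that cells whose codimensions add up to more than n do not meet.
   The bound is sometimes truncated at n instead, but that admits three segments
   in R^3 along coplanar vectors without zero coordinates: their dual great
   circles share two antipodal points, and the sum has 6 upper vertices while
   the sums over proper subfamilies predict 7. *)
Definition general_orientation m (P : 'I_m -> set V) : Prop :=
  (forall i, general_orientation1 (P i)) /\
  forall (S : {set 'I_m}) (C : 'I_m -> set V),
    (forall i, i \in S -> sph_complex (P i) (C i)) ->
    let K := sphere `&` \bigcap_(i in [set` S]) C i in
    K = set0 \/
    (minn (\sum_(i in S) sph_codim (C i)) n.+1 <= sph_codim K)%N.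

Definition upper_half : set V := [set l | 0 < l 0 ord_max].

Definition upper_part P : set (set V) :=
  [set F | face F P /\ cell F P `&` upper_half !=set0].

Definition f_upper (s : nat) P : nat :=
  #|` fset_set [set F | upper_part P F /\ aff_dim F = s] |.

(* For [S = finset.set0] this is the origin. *)
Definition minkowski_sum m (P : 'I_m -> set V) (S : {set 'I_m}) : set V :=
  [set x | exists v : 'I_m -> V,
     (forall i, i \in S -> P i (v i)) /\ x = \sum_(i in S) v i].

End Polytopes.

(* Main.v *)
(* A face of [P_S] in an upper direction [l] is the sum of the faces of the
   [P_i], [i \in S], in that direction; let [N l] be the set of those [i] for which
   the face of [P_i] is not a single point, so that [#|N l| <= n] by general
   orientation. Let [a] be the coefficients of the identity, written as
   [\sum_S a S * f_s(P_S^+) = 0]. Fix a set [T] and positive-dimensional faces of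
   the [P_i], [i \in T]; these fix the dimension of the resulting faces. The
   directions selecting them form a relatively open convex cone [D], and the cells
   to be counted for [S] are convex sets, relatively open in [D], which at a point
   [l] have total weight [\sum_(S | N l :&: S = T) a S]. This vanishes by a binomial
   identity. An Euler characteristic argument then concludes: if weights on
   convex sets that are relatively open in [D] cancel at every point of [D], then
   the weights of the nonempty sets among them sum to zero. *)
Require Import Defs.
From HB Require Import structures.
From mathcomp Require Import all_boot all_order all_algebra finmap.
From mathcomp Require Import boolp classical_sets cardinality reals.
From mathcomp Require Import ring lra zify.

Set Implicit Arguments.
Unset Strict Implicit.
Unset Printing Implicit Defensive.

Import Order.TTheory GRing.Theory Num.Theory.

Local Open Scope ring_scope.

(** * Binomial identities behind the coefficients *)

(* Compare coefficients in [(1 + x) ^- a * (1 + x) ^ q = (1 + x) ^ (q - a)]. *)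
Lemma alternating_vandermonde (a p q : nat) : (a <= q)%N ->
  \sum_(0 <= k < p.+1) (-1) ^+ k * ('C(a + k - 1, k))%:Z * ('C(q, p - k))%:Z =
  ('C(q - a, p))%:Z.
Proof.
elim: a p => [|a IHa] p le_aq.
  (* For [a = 0] only [k = 0] survives: truncated subtraction gives ['C(0, 0) = 1] there and
     ['C(k, k.+1) = 0] afterwards. *)
  rewrite big_nat_recl // big1 ?addr0 => [|k _].
    by rewrite expr0 !mul1r !subn0.
  by rewrite add0n subn1 /= (@bin_small k k.+1) // mulr0 mul0r.
elim: p => [|p IHp].
  by rewrite big_nat1 expr0 !bin0 !mul1r.
(* Pascal's rule on both sides reduces the case [a.+1], [p.+1] to the cases [a], [p.+1] and [a.+1],
   [p]. *)
have -> : ('C(q - a.+1, p.+1))%:Z = ('C(q - a, p.+1))%:Z - ('C(q - a.+1, p))%:Z.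
  by rewrite (_ : q - a = (q - a.+1).+1)%N ?binS; lia.
rewrite -IHa 1?ltnW // -IHp big_nat_recl // [X in _ = X - _]big_nat_recl //.
rewrite !bin0 -addrA; congr (_ + _); rewrite -sumrB; apply: eq_bigr => k _.
rewrite subSS (_ : a.+1 + k.+1 - 1 = (a + k).+1)%N; last lia.
rewrite binS (_ : a + k.+1 - 1 = a + k)%N; last lia.
by rewrite (_ : a.+1 + k - 1 = a + k)%N ?PoszD ?exprS; [ring|lia].
Qed.

(** Such a set is [A] together with an arbitrary set of [j - #|A|] elements outside [N]. *)
Lemma card_sets_with_trace (T : finType) (A N : {set T}) (j : nat) : A \subset N ->
  #|[set S : {set T} | (N :&: S == A) && (#|S| == j)]| =
  if (#|A| <= j)%N then 'C(#|~: N|, j - #|A|) else 0.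
Proof.
move=> subAN.
have dAN (B : {set T}) : B \subset ~: N -> A :&: B = finset.set0.
  move=> subB; apply/eqP; rewrite -finset.subset0; apply/fintype.subsetP => x.
  rewrite !inE => /andP[/(fintype.subsetP subAN) + /(fintype.subsetP subB)].
  by rewrite !inE => ->.
case: leqP => le_j; last first.
  apply: eq_card0 => S; rewrite !inE; apply/negP => /andP[/eqP EA /eqP Ej].
  by move: le_j; rewrite -Ej -EA ltnNge subset_leq_card ?finset.subsetIr.
rewrite -cards_draws -[RHS](@card_in_imset _ _ (fun B => A :|: B)); last first.
  move=> B B'; rewrite !inE => /andP[sB _] /andP[sB' _] /(congr1 (fun C => C :\: N)).
  rewrite !finset.setDUl (_ : A :\: N = finset.set0); last first.
    by apply/eqP; rewrite finset.setD_eq0.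
  rewrite !finset.set0U !finset.setDE.
  by move/finset.setIidPl: sB => ->; move/finset.setIidPl: sB' => ->.
apply: eq_card => S; apply/idP/imsetP => [|[B]]; rewrite !inE.
  move=> /andP[/eqP EA /eqP Ej]; exists (S :\: N).
    rewrite inE finset.setDE finset.subsetIr -Ej -EA -finset.setDE.
    by rewrite -(cardsID N S) finset.setIC addKn eqxx.
  by rewrite -EA finset.setIC finset.setID.
move=> /andP[sB /eqP cB] ->; rewrite finset.setIUr.
rewrite (finset.setIidPr subAN) (_ : N :&: B = finset.set0); last first.
  apply/eqP; rewrite -finset.subset0; apply/fintype.subsetP => x.
  by rewrite !inE => /andP[xN /(fintype.subsetP sB)]; rewrite inE xN.
by rewrite finset.setU0 eqxx cardsU dAN // cards0 subn0 cB subnKC ?eqxx.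
Qed.

(* The identity to prove is [\sum_S face_coef n S * f_s(P_S^+) = 0]. *)
Definition face_coef (m n : nat) (S : {set 'I_m}) : int :=
  (S == [set: 'I_m])%:Z - \sum_(0 <= j < n.+1)
    (-1) ^+ (n - j) * ('C(m - 1 - j, n - j))%:Z * (#|S| == j)%:Z.

(** The full set has trace [N], so it contributes 1 exactly when [A = N]. Counted by size, the other
    terms add up to ['C(n - #|N|, n - #|A|)], which for [A \subset N] is also 1 when [A = N] and 0
    otherwise. *)
Lemma sum_face_coef (m n : nat) (A N : {set 'I_m}) :
  (n < m)%N -> (#|N| <= n)%N -> \sum_(S | N :&: S == A) face_coef n S = 0.
Proof.
move=> lt_nm le_Nn.
have [subAN|nsubAN] := boolP (A \subset N); last first.
  rewrite big1 // => S /eqP EA; case/negP: nsubAN; rewrite -EA.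
  exact: finset.subsetIl.
have le_AN := subset_leq_card subAN; have le_An := leq_trans le_AN le_Nn.
rewrite sumrB exchange_big /=.
rewrite [X in X - _](_ : _ = (N == A)%:Z); last first.
  have [<-|neNA] := eqVneq N A.
    rewrite (bigD1 [set: 'I_m]) ?finset.setIT //= eqxx big1 ?addr0 // => S /andP[_].
    by move/negPf=> ->.
  rewrite big1 // => S /eqP EA; case: eqP => // ST.
  by rewrite -EA ST finset.setIT eqxx in neNA.
rewrite [X in _ - X](_ : _ = \sum_(0 <= j < n.+1)
    (-1) ^+ (n - j) * ('C(m - 1 - j, n - j))%:Z *
    (if (#|A| <= j)%N then 'C(#|~: N|, j - #|A|) else 0)%:Z); last first.
  apply: eq_bigr => j _; rewrite -mulr_sumr -card_sets_with_trace //.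
  congr (_ * _); rewrite -sum1_card (big_morph _ PoszD (erefl (0%N)%:Z)).
  rewrite big_mkcond [RHS]big_mkcond.
  by apply: eq_bigr => S _; rewrite inE; case: (_ == A) (_ == j) => [] [].
rewrite (@big_cat_nat _ _ _ #|A|) //=; last exact: leqW.
rewrite big_nat_cond big1 ?add0r => [|j]; last first.
  by rewrite andbT => /andP[_]; rewrite ltnNge => /negPf ->; rewrite mulr0.
(* Substituting [j = #|A| + p - k] gives the alternating convolution with parameters [m - n] and
   [m - #|N|]. *)
set p := (n - #|A|)%N; rewrite -[in index_iota _ _](add0n #|A|) big_addn.
rewrite (_ : n.+1 - #|A| = p.+1)%N; last lia.
rewrite big_nat_rev /= add0n.
have cN : #|~: N| = (m - #|N|)%N by rewrite cardsCs finset.setCK card_ord.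
rewrite (eq_big_nat _ _ (F2 := fun k => (-1) ^+ k * ('C((m - n) + k - 1, k))%:Z *
    ('C(m - #|N|, p - k))%:Z)) => [|k /andP[_ ltk]]; last first.
  rewrite leq_addl addnK cN.
  rewrite (_ : n - (p.+1 - k.+1 + #|A|) = k)%N; last first.
    by move: le_An ltk; rewrite /p; move: #|A| => a; lia.
  rewrite (_ : m - 1 - (p.+1 - k.+1 + #|A|) = m - n + k - 1)%N; last first.
    by move: le_An ltk; rewrite /p; move: #|A| => a; lia.
  by rewrite subSS.
rewrite alternating_vandermonde; last lia.
rewrite (_ : m - #|N| - (m - n) = n - #|N|)%N; last lia.
have [->|neNA] := eqVneq N A; first by rewrite binn subrr.
rewrite bin_small ?subrr //.
have : A \proper N by rewrite finset.properEneq eq_sym neNA.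
by move/proper_card; rewrite /p; lia.
Qed.

(** * Cancelling weights on intervals of the line *)

Lemma sum_by_key (I : finType) (K : choiceType) (V : nmodType) (A : pred I)
    (key : I -> K) (c : I -> V) :
  (forall b, \sum_(i | A i && (key i == b)) c i = 0) -> \sum_(i | A i) c i = 0.
Proof.
move=> zero.
(* [K] may be infinite, so the partition runs over the finite image of [key]. *)
rewrite (partition_big (fun i => SeqSub (codom_f key i)) predT) //=.
by rewrite big1 // => b _; rewrite -[RHS](zero (val b)).
Qed.

Section Line.
Local Open Scope classical_set_scope.
Context {R : realType} {I : finType}.
Variables (Q : I -> set R) (c : I -> int).
Hypothesis itvQ : forall i x y z, Q i x -> Q i y -> x <= z <= y -> Q i z.
Hypothesis zeroQ : forall x, \sum_(i | `[< Q i x >]) c i = 0.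

(* [None] stands for the end [+oo]. *)
Definition ends_at (A : set R) (b : option R) : Prop :=
  if b is Some b then (forall q, A q -> q < b) /\
    (forall t, t < b -> exists2 q, A q & t < q)
  else forall t, exists2 q, A q & t < q.

Lemma finite_ubound (f : I -> R) : exists M, forall i, f i <= M.
Proof.
exists (\sum_i `|f i|) => i; rewrite (bigD1 i) //=.
by rewrite (le_trans (ler_norm _)) // lerDl sumr_ge0.
Qed.

Section OpenIntervals.
Hypothesis ltQ : forall i x, Q i x -> exists2 q, Q i q & q < x.
Hypothesis gtQ : forall i x, Q i x -> exists2 q, Q i q & x < q.

Lemma ends_at_exists i : Q i !=set0 -> exists b, ends_at (Q i) b.
Proof.
move=> neQ; have [[M ubM]|unb] := pselect (has_ubound (Q i)).
  exists (Some (sup (Q i))); split=> [q Qq|t lt_t].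
    have [q' Qq' /lt_le_trans -> //] := gtQ Qq.
    by apply: ub_le_sup => //; exists M.
  by have [q Qq] := sup_gt neQ lt_t; exists q.
exists None => t; apply: contrapT => noq; apply: unb; exists t => q Qq.
by rewrite leNgt; apply/negP => lt_tq; apply: noq; exists q.
Qed.

Lemma ends_at_nonempty (A : set R) b : ends_at A b -> A !=set0.
Proof.
case: b => [b [_ /(_ (b - 1))]|/(_ 0) [q Aq _]]; last by exists q.
by case=> [|q Aq _]; [rewrite ltrBlDr ltrDl | exists q].
Qed.

Lemma ends_at_unique (A : set R) b b' : ends_at A b -> ends_at A b' -> b = b'.
Proof.
case: b b' => [b|] [b'|] //=; last first.
- by move=> /(_ b') [q Aq lt_b'q] [/(_ q Aq) /(lt_trans lt_b'q)]; rewrite ltxx.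
- by move=> [lt_b _] /(_ b) [q /lt_b /lt_trans H /H]; rewrite ltxx.
move=> [lt_b b_lt] [lt_b' b'_lt]; congr Some; apply/eqP.
rewrite eq_le !leNgt; apply/andP; split; apply/negP.
  by move=> /b_lt [q /lt_b' /lt_trans H /H]; rewrite ltxx.
by move=> /b'_lt [q /lt_b /lt_trans H /H]; rewrite ltxx.
Qed.

Lemma left_germ b i : exists2 t, t < b & forall x, t < x < b ->
  (Q i x <-> Q i b \/ ends_at (Q i) (Some b)).
Proof.
have [Qb|nQb] := pselect (Q i b).
  have [q Qq lt_qb] := ltQ Qb; exists q => // x /andP[/ltW qx /ltW xb].
  by split=> // _; [left | apply: (itvQ Qq Qb); rewrite qx].
have [Eb|nEb] := pselect (ends_at (Q i) (Some b)).
  have [lt_b b_lt] := Eb; have [q Qq _] := b_lt (b - 1) ltac:(lra).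
  exists q => [|x /andP[/ltW qx /b_lt [q' Qq' /ltW xq']]]; first exact: lt_b.
  by split=> _; [right | apply: (itvQ Qq Qq'); rewrite qx].
have [[q0 [Qq0 ltq0]]|noq] := pselect (exists q, Q i q /\ q < b).
  have ltQb q : Q i q -> q < b.
    move=> Qq; rewrite ltNge; apply/negP => bq; apply: nQb.
    by apply: (itvQ Qq0 Qq); rewrite (ltW ltq0).
  have [t [tb ht]] : exists t, t < b /\ forall q, Q i q -> q <= t.
    apply: contrapT => no; apply: nEb; split=> // t tb.
    apply: contrapT => noq; apply: no; exists t; split=> // q Qq.
    by rewrite leNgt; apply/negP => tq; apply: noq; exists q.
  exists t => // x /andP[tx _]; split=> [/ht|[] //].
  by rewrite leNgt tx.
exists (b - 1) => [|x /andP[_ xb]]; first lra.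
by split=> [Qx|[] //]; case: noq; exists x.
Qed.

(** Just to the left of [b] lie the intervals that contain [b] and those that end at [b].
    Subtracting the relation at [b] from the one there leaves the latter. For the end [None], a
    point far to the right does. *)
Lemma sum_ends_at b : \sum_(i | `[< ends_at (Q i) b >]) c i = 0.
Proof.
case: b => [b|].
  have /choice [t ht] : forall i, exists t, t < b /\ forall x, t < x < b ->
      (Q i x <-> Q i b \/ ends_at (Q i) (Some b)).
    by move=> i; have [t] := left_germ b i; exists t.
  have [x xb hx] : exists2 x, x < b & forall i, t i < x.
    (* The distance from [x] to [b] is the inverse of a number above every [(b - t i)^-1]; the
       maximum with 1 keeps it positive even if [I] is empty. *)
    have [M hM] := finite_ubound (fun i => (b - t i)^-1).
    pose M1 := Num.max M 1.
    have M1_gt0 : 0 < M1 by rewrite lt_max ltr01 orbT.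
    exists (b - (M1 + 1)^-1) => [|i].
      by rewrite ltrBlDr ltrDl invr_gt0 addr_gt0.
    have bt : 0 < b - t i by rewrite subr_gt0; case: (ht i).
    rewrite ltrBrDl -ltrBrDr -[ltRHS]invrK ltf_pV2 ?posrE ?invr_gt0 //; last first.
      exact: addr_gt0.
    by rewrite (le_lt_trans (hM i)) // (@le_lt_trans _ _ M1) ?ltrDl // le_max lexx.
  have QxE i : Q i x <-> Q i b \/ ends_at (Q i) (Some b).
    by case: (ht i) => _; apply; rewrite hx xb.
  have zero_b : \sum_(i | `[< Q i x >] && `[< Q i b >]) c i = 0.
    rewrite -[RHS](zeroQ b); apply: eq_bigl => i.
    apply/andP/asboolP => [[_ /asboolP]//|Qb]; split; apply/asboolP => //.
    by apply/QxE; left.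
  have := zeroQ x; rewrite (bigID (fun i => `[< Q i b >])) /= zero_b add0r.
  move=> zero_nb; rewrite -[RHS]zero_nb.
  apply: eq_bigl => i; apply/asboolP/andP => [E|[/asboolP /QxE [Qb|//] /asboolP //]].
  split; [by apply/asboolP/QxE; right | apply/asboolP => Qb].
  by have [/(_ _ Qb)] := E; rewrite ltxx.
have /choice [t ht] : forall i, exists t, forall x, t < x ->
    (Q i x <-> ends_at (Q i) None).
  move=> i; have [E|nE] := pselect (ends_at (Q i) None).
    have [q Qq _] := E 0; exists q => x /ltW qx; split=> // _.
    by have [q' Qq' /ltW xq'] := E x; apply: (itvQ Qq Qq'); rewrite qx.
  have [t ht] : exists t, forall q, Q i q -> q <= t.
    apply: contrapT => no; apply: nE => t.
    apply: contrapT => noq; apply: no; exists t => q Qq.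
    by rewrite leNgt; apply/negP => tq; apply: noq; exists q.
  by exists t => x tx; split=> // /ht; rewrite leNgt tx.
have [M hM] := finite_ubound t.
rewrite -[RHS](zeroQ (M + 1)); apply: eq_bigl => i; apply: asbool_equiv_eq.
apply: iff_sym; apply: ht.
by rewrite (le_lt_trans (hM i)) // ltrDl.
Qed.

(** Every nonempty interval of the family has exactly one right end, so the sum can be grouped by
    right ends. *)
Lemma sum_open_intervals : \sum_(i | `[< Q i !=set0 >]) c i = 0.
Proof.
have /choice [b hb] : forall i, exists b, Q i !=set0 -> ends_at (Q i) b.
  move=> i; have [/ends_at_exists [b]|] := pselect (Q i !=set0); first by exists b.
  by exists None.
apply: (sum_by_key (key := b)) => b0; rewrite -[RHS](sum_ends_at b0).
apply: eq_bigl => i; apply/andP/asboolP => [[/asboolP /hb E /eqP <- //]|E].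
have neQ := ends_at_nonempty E.
by split; [apply/asboolP | apply/eqP/ends_at_unique/E/hb].
Qed.

End OpenIntervals.

(** If [D] has two points, the sets [Q i] have no first or last point and the open case applies. If
    [D] is one point, the relation at that point is the claim. *)
Lemma sum_relatively_open_intervals (D : set R) :
  (forall x y, D x -> D y -> exists2 e, 0 < e & D (x + e * (x - y))) ->
  (forall i x, Q i x -> D x) ->
  (forall i x y, Q i x -> D y -> exists2 e, 0 < e & Q i (x + e * (y - x))) ->
  \sum_(i | `[< Q i !=set0 >]) c i = 0.
Proof.
move=> roD subQ openQ.
have [[y1 [y2 [D1 D2 y12]]]|D1] :=
    pselect (exists y1 y2, [/\ D y1, D y2 & y1 < y2]).
  (* A second point of [D] lies on one side of [x]; pushing [x] away from it gives a point of [D] on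
     the other side. *)
  have two x : D x -> (exists2 y, D y & y < x) /\ (exists2 y, D y & x < y).
    move=> Dx; have [y [Dy neq_xy]] : exists y, D y /\ y != x.
      have [xy1|] := eqVneq y1 x; last by exists y1.
      by exists y2; rewrite -xy1 gt_eqF.
    have [e e0 De] := roD x y Dx Dy.
    have [/[dup] xy|yx|/esym/eqP] := ltgtP x y; last by rewrite (negPf neq_xy).
      rewrite -subr_gt0 => d0; split; last by exists y.
      by exists (x + e * (x - y)) => //; nra.
    split; first by exists y.
    by exists (x + e * (x - y)) => //; rewrite -subr_gt0 in yx; nra.
  apply: sum_open_intervals => i x Qx.
    have [[y Dy yx] _] := two x (subQ _ _ Qx); have [e e0 Qe] := openQ i x y Qx Dy.
    by exists (x + e * (y - x)) => //; rewrite -subr_gt0 in yx; nra.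
  have [_ [y Dy yx]] := two x (subQ _ _ Qx); have [e e0 Qe] := openQ i x y Qx Dy.
  by exists (x + e * (y - x)) => //; rewrite -subr_gt0 in yx; nra.
have [[x Dx]|noD] := pselect (D !=set0).
  rewrite -[RHS](zeroQ x); apply: eq_bigl => i; apply: asbool_equiv_eq.
  split=> [[y Qy]|]; last by exists x.
  suff -> : x = y by [].
  apply/eqP; rewrite eq_le !leNgt; apply/andP; split; apply/negP => lt_xy.
    by apply: D1; exists y, x; split=> //; apply: subQ Qy.
  by apply: D1; exists x, y; split=> //; apply: subQ Qy.
rewrite big1 // => i /asboolP [x Qx]; by case: noD; exists x; apply: subQ Qx.
Qed.

End Line.

(** * Cancelling weights on convex sets in any dimension *)

Section Sweep.
Local Open Scope classical_set_scope.

(** Segments in [D] can be prolonged beyond their ends; for convex sets in finite dimension this is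
    relative openness, stated without a topology. *)
Definition rel_open {R : realType} {V : lmodType R} (D : set V) : Prop :=
  forall x y, D x -> D y -> exists2 e, 0 < e & D (x + e *: (x - y)).

(** Openness is tested only along segments towards points of [D], a form that passes to projections
    and fibres. *)
Definition open_in {R : realType} {V : lmodType R} (D Q : set V) : Prop :=
  forall x y, Q x -> D y -> exists2 e, 0 < e & Q (x + e *: (y - x)).

Definition convex {R : realType} {V : lmodType R} (Q : set V) : Prop :=
  forall x y t, Q x -> Q y -> 0 <= t <= 1 -> Q (x + t *: (y - x)).

(* Sweeping out one coordinate: over each point of the projection of [D], the
   fibres are intervals, for which the weights cancel by the one-dimensional
   case, so the hypothesis passes to the projections. *)
Lemma sum_nonempty_convex (R : realType) (d : nat) (I : finType)
    (D : set 'rV[R]_d) (Q : I -> set 'rV[R]_d) (c : I -> int) :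
  rel_open D -> (forall i, Q i `<=` D) -> (forall i, open_in D (Q i)) ->
  (forall i, convex (Q i)) ->
  (forall x, \sum_(i | `[< Q i x >]) c i = 0) ->
  \sum_(i | `[< Q i !=set0 >]) c i = 0.
Proof.
elim: d D Q => [|d IHd] D Q roD subQ openQ convQ zeroQ.
  rewrite -[RHS](zeroQ 0); apply: eq_bigl => i; apply: asbool_equiv_eq.
  by split=> [[x]|]; [rewrite thinmx0 | exists 0].
pose pt (t : R) (x : 'rV[R]_d) : 'rV[R]_(1 + d) := row_mx t%:M x.
pose proj (A : set 'rV[R]_(1 + d)) := [set x | exists t, A (pt t x)].
have ptE (x : 'rV[R]_(1 + d)) : x = pt (lsubmx x 0 0) (rsubmx x).
  by rewrite /pt -mx11_scalar hsubmxK.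
have pt_comb t x t' x' e : pt t x + e *: (pt t' x' - pt t x) =
    pt (t + e * (t' - t)) (x + e *: (x' - x)).
  rewrite /pt opp_row_mx add_row_mx scale_row_mx add_row_mx; congr row_mx.
  by apply/matrixP => i j; rewrite !mxE !ord1 !mulr1n.
have pt_away t x t' x' e : pt t x + e *: (pt t x - pt t' x') =
    pt (t + e * (t - t')) (x + e *: (x - x')).
  rewrite /pt opp_row_mx add_row_mx scale_row_mx add_row_mx; congr row_mx.
  by apply/matrixP => i j; rewrite !mxE !ord1 !mulr1n.
have -> : \sum_(i | `[< Q i !=set0 >]) c i = \sum_(i | `[< proj (Q i) !=set0 >]) c i.
  apply: eq_bigl => i; apply: asbool_equiv_eq; split=> [[x Qx]|[x [t Qx]]].
    by exists (rsubmx (x : 'rV_(1 + d))), (lsubmx (x : 'rV_(1 + d)) 0 0); rewrite -ptE.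
  by exists (pt t x).
apply: (IHd (proj D)) => [x y [t Dx] [t' Dy]|i x [t Qx]|i x y [t Qx] [t' Dy]|
                          i x y a [t Qx] [t' Qy] a01|x].
- have [e e0] := roD _ _ Dx Dy; rewrite pt_away => De.
  by exists e => //; eexists; apply: De.
- by exists t; apply: subQ Qx.
- have [e e0] := openQ i _ _ Qx Dy; rewrite pt_comb => Qe.
  by exists e => //; eexists; apply: Qe.
- have := convQ i _ _ a Qx Qy a01; rewrite pt_comb => Qa.
  by eexists; apply: Qa.
pose fib (A : set 'rV[R]_(1 + d)) : set R := [set t | A (pt t x)].
apply: (@sum_relatively_open_intervals R I (fun i => fib (Q i)) c _ _ (fib D)).
- move=> i t t' s Qt Qt' /andP[ts st'].
  have [t_t'|neq] := eqVneq t t'.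
    by have -> : s = t by apply: le_anti; rewrite ts t_t' st'.
  have tt' : t < t' by rewrite lt_neqAle neq (le_trans ts).
  have := convQ i _ _ ((s - t) / (t' - t)) Qt Qt'; rewrite pt_comb subrr scaler0 addr0.
  rewrite divfK ?subr_eq0 1?eq_sym // (addrC t) subrK; apply.
  rewrite divr_ge0 ?subr_ge0 ?(ltW tt') //= ler_pdivrMr ?subr_gt0 // mul1r.
  by rewrite lerD2r.
- by move=> t; apply: zeroQ.
- move=> t t' Dt Dt'; have [e e0] := roD _ _ Dt Dt'.
  by rewrite pt_away subrr scaler0 addr0; exists e.
- by move=> i t; apply: subQ.
- move=> i t t' Qt Dt'; have [e e0] := openQ i _ _ Qt Dt'.
  by rewrite pt_comb subrr scaler0 addr0; exists e.
Qed.

End Sweep.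

(** * Scalar products and faces of convex hulls *)

Section Dot.
Context {R : realType} {d : nat}.
Implicit Types u v x : 'rV[R]_d.

Lemma dotDl u v x : dot (u + v) x = dot u x + dot v x.
Proof. by rewrite -big_split; apply: eq_bigr => i _; rewrite mxE mulrDl. Qed.

Lemma dotZl a u x : dot (a *: u) x = a * dot u x.
Proof. by rewrite mulr_sumr; apply: eq_bigr => i _; rewrite mxE mulrA. Qed.

Lemma dotC u x : dot u x = dot x u.
Proof. by apply: eq_bigr => i _; rewrite mulrC. Qed.

Lemma dotDr u v x : dot x (u + v) = dot x u + dot x v.
Proof. by rewrite !(dotC x) dotDl. Qed.

Lemma dotZr a u x : dot x (a *: u) = a * dot x u.
Proof. by rewrite !(dotC x) dotZl. Qed.

Lemma dotBl u v x : dot (u - v) x = dot u x - dot v x.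
Proof. by rewrite -scaleN1r dotDl dotZl mulN1r. Qed.

Lemma dotBr u v x : dot x (u - v) = dot x u - dot x v.
Proof. by rewrite !(dotC x) dotBl. Qed.

Lemma dot_sumr (I : finType) (A : pred I) (F : I -> 'rV[R]_d) x :
  dot x (\sum_(i | A i) F i) = \sum_(i | A i) dot x (F i).
Proof.
have dot0 : dot x 0 = 0 by rewrite -(scale0r 0) dotZr mul0r.
by rewrite (big_morph (dot x) (id1 := 0) (op1 := +%R)) // => u v; rewrite dotDr.
Qed.

Lemma dot_gt0 x : x != 0 -> 0 < dot x x.
Proof.
move=> nz; rewrite lt_neqAle sumr_ge0 => [|i _]; last by rewrite -expr2 sqr_ge0.
rewrite andbT eq_sym; apply: contra nz => /eqP /psumr_eq0P z.
apply/eqP/matrixP => i j; rewrite ord1 mxE; apply/eqP.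
by rewrite -sqrf_eq0 expr2 z // => k _; rewrite -expr2 sqr_ge0.
Qed.

End Dot.

Section ConvexHull.
Context {R : realType} {n k : nat}.
Variable v : 'I_k.+1 -> 'rV[R]_n.+1.
Implicit Types (l x : 'rV[R]_n.+1).

Lemma conv_hull_vertex j : conv_hull v (v j).
Proof.
exists (fun i => (i == j)%:R); split=> [i||].
- exact: ler0n.
- by rewrite (bigD1 j) //= eqxx big1 ?addr0 // => i /negPf ->.
- rewrite (bigD1 j) //= eqxx scale1r big1 ?addr0 // => i /negPf ->.
  by rewrite scale0r.
Qed.

Lemma conv_hull_dot_le l (M : R) x :
  (forall j, dot l (v j) <= M) -> conv_hull v x -> dot l x <= M.
Proof.
move=> le_M [a [a0 a1 ->]]; rewrite dot_sumr -[M]mul1r -a1 mulr_suml.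
by apply: ler_sum => j _; rewrite dotZr ler_wpM2l.
Qed.

Lemma exists_maximal_vertex l : exists j, maximizers l (conv_hull v) (v j).
Proof.
case: (@Order.TotalTheory.arg_maxP _ _ _ ord0 predT (fun j => dot l (v j))) => // j _ maxj.
exists j; split=> [|y]; first exact: conv_hull_vertex.
by apply: conv_hull_dot_le => i; apply: maxj.
Qed.

(** The gaps [dot l x - dot l (v i)] are nonnegative with weighted sum zero, so every generator of
    nonzero weight is maximal. *)
Lemma maximizers_conv_hull l x : maximizers l (conv_hull v) x ->
  exists a : 'I_k.+1 -> R,
    [/\ forall j, 0 <= a j, \sum_j a j = 1, x = \sum_j a j *: v j &
        forall j, a j != 0 -> maximizers l (conv_hull v) (v j)].
Proof.
move=> [[a [a0 a1 xE]] maxx]; exists a; split=> // j aj.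
suff Ej : dot l (v j) = dot l x.
  by split=> [|y /maxx]; [exact: conv_hull_vertex | rewrite Ej].
have ge0 i : true -> 0 <= a i * (dot l x - dot l (v i)).
  by move=> _; rewrite mulr_ge0 // subr_ge0; apply/maxx/conv_hull_vertex.
have /(psumr_eq0P ge0) /(_ j isT) /eqP : \sum_i a i * (dot l x - dot l (v i)) = 0.
  under eq_bigr do rewrite mulrBr -(dotZr _ (v _)).
  by rewrite sumrB -mulr_suml a1 mul1r -dot_sumr -xE subrr.
by rewrite mulf_eq0 (negPf aj) subr_eq0 => /eqP.
Qed.

(** A face is the hull of the generators in it, so inclusion of faces can be tested on
    generators. *)
Lemma maximizers_conv_hull_sub l l' :
  (forall j, maximizers l (conv_hull v) (v j) -> maximizers l' (conv_hull v) (v j)) ->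
  forall x, maximizers l (conv_hull v) x -> maximizers l' (conv_hull v) x.
Proof.
move=> sub x maxx; have [a [a0 a1 xE maxa]] := maximizers_conv_hull maxx.
split=> [|y hy]; first by case: maxx.
rewrite xE dot_sumr -[leLHS]mul1r -a1 mulr_suml; apply: ler_sum => j _.
rewrite dotZr; have [->|/maxa/sub [_ maxj]] := eqVneq (a j) 0; first by rewrite !mul0r.
by rewrite ler_wpM2l // maxj.
Qed.

Lemma maximizers_conv_hull_point l p :
  (forall j, maximizers l (conv_hull v) (v j) -> v j = p) ->
  forall x, maximizers l (conv_hull v) x -> x = p.
Proof.
move=> eqp x /maximizers_conv_hull [a [_ a1 -> maxa]].
rewrite -[p]scale1r -a1 scaler_suml; apply: eq_bigr => j _.
by have [->|/maxa/eqp ->] := eqVneq (a j) 0; rewrite ?scale0r.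
Qed.

End ConvexHull.

(** The inverse of [M] is a common step for all [i], since [M] exceeds every ratio of [|g i|] to
    [f i]. *)
Lemma small_perturbation (R : realType) (I : finType) (f g : I -> R) :
  (forall i, 0 < f i) -> exists2 e, 0 < e & forall i, 0 < f i + e * g i.
Proof.
move=> f0; pose M := 1 + \sum_i `|g i| / f i.
have M0 : 0 < M by rewrite ltr_pwDl // sumr_ge0 // => i _; rewrite divr_ge0 // ltW.
exists M^-1 => [|i]; first by rewrite invr_gt0.
have : `|g i| / f i < M.
  rewrite ltr_pwDl // (bigD1 i) //= lerDl sumr_ge0 // => j _.
  by rewrite divr_ge0 // ltW.
rewrite ltr_pdivrMr // -ltr_pdivrMl // => lt_f.
rewrite -ltrBlDr sub0r; apply: le_lt_trans lt_f.
by rewrite -mulrN ler_wpM2l ?invr_ge0 ?(ltW M0) // -normrN ler_norm.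
Qed.

(** * Faces of Minkowski sums *)

Section Minkowski.
Context {R : realType} {n m : nat}.
Variable P : 'I_m -> set 'rV[R]_n.+1.
Implicit Types (l x : 'rV[R]_n.+1) (S : {set 'I_m}).

(** Exchanging a single summand changes only its own term in the scalar product with [l]. *)
Lemma maximizers_summand l S (v : 'I_m -> 'rV[R]_n.+1) :
  (forall i, i \in S -> P i (v i)) ->
  maximizers l (minkowski_sum P S) (\sum_(i in S) v i) ->
  forall i, i \in S -> maximizers l (P i) (v i).
Proof.
move=> Pv [_ maxv] i iS; split=> [|y Py]; first exact: Pv.
pose u j := if j == i then y else v j.
have /maxv : minkowski_sum P S (\sum_(j in S) u j).
  exists u; split=> // j jS; rewrite /u; case: eqP => [->//|_]; exact: Pv.
rewrite (bigD1 i iS) [in leRHS](bigD1 i iS) /= /u eqxx !dotDr.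
rewrite [X in _ + dot l X <= _](eq_bigr v) ?lerD2r // => j /andP[_ /negPf -> //].
Qed.

Lemma maximizers_minkowski l S x : maximizers l (minkowski_sum P S) x <->
  exists v, (forall i, i \in S -> maximizers l (P i) (v i)) /\ x = \sum_(i in S) v i.
Proof.
split=> [[[v [Pv xE]] maxx]|[v [maxv ->]]].
  exists v; split=> //; apply: maximizers_summand => //.
  by split=> [|y /maxx]; [exists v | rewrite xE].
split=> [|_ [u [Pu ->]]]; first by exists v; split=> // i /maxv [].
by rewrite !dot_sumr; apply: ler_sum => i iS; have [_] := maxv i iS; apply; apply: Pu.
Qed.

End Minkowski.

(** * Encoding faces by finite sets of vertices *)

Section Patterns.
Context {R : realType} {n m : nat} {J : finType}.
Local Notation V := 'rV[R]_n.+1.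
(* [w j] runs over the vertices of all the polytopes, [tg j] telling which
   polytope [w j] belongs to. *)
Variables (P : 'I_m -> set V) (tg : J -> 'I_m) (w : J -> V).
Hypothesis vertP : forall j, P (tg j) (w j).
Hypothesis exmaxP : forall i l, exists j, tg j = i /\ maximizers l (P i) (w j).
Hypothesis subP : forall i l l',
  (forall j, tg j = i -> maximizers l (P i) (w j) -> maximizers l' (P i) (w j)) ->
  forall x, maximizers l (P i) x -> maximizers l' (P i) x.
Hypothesis pointP : forall i l p,
  (forall j, tg j = i -> maximizers l (P i) (w j) -> w j = p) ->
  forall x, maximizers l (P i) x -> x = p.
Implicit Types (l x : V) (S T : {set 'I_m}) (X Y : {set J}).

Definition max_vertices l : {set J} :=
  [set j | `[< maximizers l (P (tg j)) (w j) >]].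

(* By [maximizers_eq_pattern], this finite set encodes the face of the Minkowski
   sum over [S] in the direction [l]. *)
Definition pattern S l : {set J} := [set j in max_vertices l | tg j \in S].

(** Points are compared rather than indices, because a generating family may repeat a point. *)
Definition nontrivial X : {set 'I_m} :=
  [set i | [exists j in X, [exists j' in X,
    [&& tg j == i, tg j' == i & w j != w j']]]].

(* The part of a face pattern coming from the summands that contribute more than
   one point; it determines the dimension of the face. *)
Definition core X : {set J} := [set j in X | tg j \in nontrivial X].

Lemma nontrivialP X i : reflect
  (exists j j', [/\ j \in X, j' \in X, tg j = i, tg j' = i & w j != w j'])
  (i \in nontrivial X).
Proof.
rewrite inE; apply: (iffP exists_inP) => [[j jX /exists_inP [j' j'X]]|].
  by move=> /and3P[/eqP ? /eqP ? ?]; exists j, j'.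
move=> [j [j' [jX j'X <- tj' neq]]]; exists j => //; apply/exists_inP.
by exists j' => //; rewrite tj' eqxx.
Qed.

Lemma max_verticesP l j : reflect
  (forall j', tg j' = tg j -> dot l (w j') <= dot l (w j)) (j \in max_vertices l).
Proof.
rewrite inE; apply: (iffP (asboolP _)) => [[_ maxj] j' tj'|maxj].
  by apply: maxj; rewrite -tj'.
have [j0 [tj0 [_ max0]]] := exmaxP (tg j) l; split=> // y /max0 /le_trans; apply.
exact: maxj.
Qed.

Lemma exists_max_vertex l i : exists2 j, tg j = i & j \in max_vertices l.
Proof.
by have [j [tj maxj]] := exmaxP i l; exists j => //; rewrite inE; apply/asboolP; rewrite tj.
Qed.

Lemma tags_pattern S l : tg @: pattern S l = S.
Proof.
apply/setP => i; apply/imsetP/idP => [[j] |iS]; first by rewrite inE => /andP[_ ?] ->.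
by have [j tj jA] := exists_max_vertex l i; exists j; rewrite // inE jA tj.
Qed.

Lemma nontrivial_pattern S l :
  nontrivial (pattern S l) = nontrivial (max_vertices l) :&: S.
Proof.
apply/setP => i; rewrite finset.in_setI; apply/nontrivialP/andP.
  move=> [j [j' []]]; rewrite [in X in X -> _]inE [in X in _ -> X -> _]inE.
  move=> /andP[jA jS] /andP[j'A _] tj tj' neq; split; last by rewrite -tj.
  by apply/nontrivialP; exists j, j'.
move=> [/nontrivialP [j [j' [jA j'A tj tj' neq]]] iS]; exists j, j'.
by split=> //; rewrite inE ?jA ?j'A ?tj ?tj'.
Qed.

Lemma core_pattern S l :
  core (pattern S l) = pattern (nontrivial (max_vertices l) :&: S) l.
Proof.
apply/setP => j; rewrite inE nontrivial_pattern !inE.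
by case: (tg j \in S); rewrite ?andbT ?andbF.
Qed.

(** A maximal vertex of one summand extends to a maximizer of the sum; if the faces agree, its
    summands are maximal for the other direction too. Conversely, the pattern determines the face of
    each summand by [subP]. *)
Lemma maximizers_eq_pattern S l l' :
  maximizers l (minkowski_sum P S) = maximizers l' (minkowski_sum P S) <->
  pattern S l = pattern S l'.
Proof.
split=> [|eqX].
  suff sub l1 l2 : maximizers l1 (minkowski_sum P S) =
      maximizers l2 (minkowski_sum P S) -> pattern S l1 \subset pattern S l2.
    by move=> eqF; apply/eqP; rewrite finset.eqEsubset !sub.
  move=> eqF; apply/fintype.subsetP => j; rewrite 2!inE => /andP[/asboolP maxj jS].
  rewrite 2!inE jS andbT; apply/asboolP.
  have /choice [u hu] : forall i, exists x, maximizers l1 (P i) x.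
    by move=> i; have [j' [_ ?]] := exmaxP i l1; exists (w j').
  pose v i := if i == tg j then w j else u i.
  have maxv i : maximizers l1 (P i) (v i) by rewrite /v; case: eqP => [->|].
  have : maximizers l2 (minkowski_sum P S) (\sum_(i in S) v i).
    by rewrite -eqF; apply/maximizers_minkowski; exists v.
  have Pv i : i \in S -> P i (v i) by case: (maxv i).
  by move=> /(maximizers_summand Pv) /(_ _ jS); rewrite /v eqxx.
suff sub l1 l2 i x : pattern S l1 = pattern S l2 -> i \in S ->
    maximizers l1 (P i) x -> maximizers l2 (P i) x.
  apply/predeqP => x; split=> /maximizers_minkowski [v [maxv ->]];
    apply/maximizers_minkowski; exists v; split=> // i iS;
    by apply: sub (maxv i iS).
move=> {}eqX iS; apply: subP => j tj maxj.
have : j \in pattern S l1 by rewrite 2!inE tj iS andbT; apply/asboolP.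
by rewrite eqX 2!inE tj => /andP[/asboolP].
Qed.

(** Summands whose face is a single point only translate the face, and [aff_dim] depends on
    differences alone. *)
Lemma aff_dim_maximizers_core S l :
  aff_dim (maximizers l (minkowski_sum P S)) =
  aff_dim (maximizers l (minkowski_sum P (nontrivial (max_vertices l) :&: S))).
Proof.
set T := _ :&: S.
have /choice [p maxp] : forall i, exists x, maximizers l (P i) x.
  by move=> i; have [j' [_ ?]] := exmaxP i l; exists (w j').
have trivT i x : i \in S -> i \notin T -> maximizers l (P i) x -> x = p i.
  rewrite finset.in_setI => -> /=; rewrite andbT => triv maxx.
  suff eqw j j' : tg j = i -> tg j' = i -> maximizers l (P i) (w j) ->
      maximizers l (P i) (w j') -> w j = w j'.
    have [j0 [tj0 max0]] := exmaxP i l.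
    have to_w := pointP (fun j tj maxj => eqw _ _ tj tj0 maxj max0).
    by rewrite (to_w _ maxx) (to_w _ (maxp i)).
  move=> tj tj' maxj maxj'; apply/eqP; apply: contraR triv => neq.
  by apply/nontrivialP; exists j, j'; split=> //; rewrite inE ?tj ?tj'; apply/asboolP.
have subT : T \subset S by apply: finset.subsetIr.
have sumT (v u : 'I_m -> V) : (forall i, i \in S -> i \notin T -> v i = u i) ->
    \sum_(i in S) v i - \sum_(i in S) u i = \sum_(i in T) v i - \sum_(i in T) u i.
  move=> eq_out; rewrite -!sumrB (big_setID T) /= (finset.setIidPr subT).
  rewrite [X in _ + X]big1 ?addr0 // => i; rewrite inE => /andP[iT iS].
  by rewrite eq_out ?subrr.
rewrite /aff_dim; congr lin_dim; apply/predeqP => z; split.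
  move=> [x [y [/maximizers_minkowski [v [maxv ->]]]]].
  move=> /maximizers_minkowski [u [maxu ->]] ->.
  exists (\sum_(i in T) v i), (\sum_(i in T) u i); split.
  - by apply/maximizers_minkowski; exists v; split=> // i /(fintype.subsetP subT)/maxv.
  - by apply/maximizers_minkowski; exists u; split=> // i /(fintype.subsetP subT)/maxu.
  - by apply: sumT => i iS iT; rewrite (trivT _ _ iS iT (maxv i iS))
       (trivT _ _ iS iT (maxu i iS)).
move=> [x [y [/maximizers_minkowski [v [maxv ->]]]]].
move=> /maximizers_minkowski [u [maxu ->]] ->.
(* Outside [T] the fixed maximizers [p i] are filled in; they cancel in the difference. *)
pose ext (f : 'I_m -> V) i := if i \in T then f i else p i.
have extT f : \sum_(i in T) f i = \sum_(i in T) ext f i.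
  by apply: eq_bigr => i iT; rewrite /ext iT.
exists (\sum_(i in S) ext v i), (\sum_(i in S) ext u i); split.
- apply/maximizers_minkowski; exists (ext v); split=> // i _; rewrite /ext.
  by case: ifP => // /maxv.
- apply/maximizers_minkowski; exists (ext u); split=> // i _; rewrite /ext.
  by case: ifP => // /maxu.
- by rewrite (extT v) (extT u) -sumT // => i _ /negPf iT; rewrite /ext iT.
Qed.

(** The tags of the core recover the set of nontrivial summands, and over that set equal patterns
    mean equal faces. *)
Lemma aff_dim_eq_core S S' l l' :
  core (pattern S l) = core (pattern S' l') ->
  aff_dim (maximizers l (minkowski_sum P S)) =
  aff_dim (maximizers l' (minkowski_sum P S')).
Proof.
rewrite !core_pattern => eqX; rewrite aff_dim_maximizers_core [RHS]aff_dim_maximizers_core.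
have := congr1 (fun X => tg @: X) eqX; rewrite /= !tags_pattern => eqT.
by congr aff_dim; rewrite -eqT; apply/maximizers_eq_pattern; rewrite eqX eqT.
Qed.

(** Ties among the maximal vertices persist by the assumption on [u]; all else is a finite set of
    strict inequalities, which survive a small step. *)
Lemma pattern_perturbation S l u : 0 < l 0 ord_max ->
  (forall j j', j \in pattern S l -> j' \in pattern S l -> tg j = tg j' ->
     dot u (w j) = dot u (w j')) ->
  exists2 e, 0 < e & 0 < (l + e *: u) 0 ord_max /\ pattern S (l + e *: u) = pattern S l.
Proof.
move=> l0 ties.
pose gap (jj : J * J) := [&& tg jj.1 == tg jj.2, jj.1 \in max_vertices l
                             & jj.2 \notin max_vertices l].
(* [None] carries the positivity of the last coordinate; a pair that is no gap gets the harmless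
   inequality [0 < 1 + e * 0]. *)
pose f (o : option (J * J)) := if o is Some jj then
  if gap jj then dot l (w jj.1) - dot l (w jj.2) else 1 else l 0 ord_max.
pose g (o : option (J * J)) := if o is Some jj then
  if gap jj then dot u (w jj.1) - dot u (w jj.2) else 0 else u 0 ord_max.
have f0 o : 0 < f o.
  case: o => [jj|] //=; case: ifP => // /and3P[/eqP tjj maxj /max_verticesP nmax].
  rewrite subr_gt0 ltNge; apply/negP => le_jj; apply: nmax => j' tj'.
  by apply: le_trans le_jj; move/max_verticesP: maxj; apply; rewrite tjj.
have [e e0 he] := small_perturbation g f0.
exists e => //; split; first by have := he None; rewrite !mxE.
have gapE j j' : tg j = tg j' -> j \in max_vertices l -> j' \notin max_vertices l ->
    dot (l + e *: u) (w j') < dot (l + e *: u) (w j).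
  move=> tjj jA j'A; have := he (Some (j, j')).
  rewrite /= /gap /= tjj eqxx jA j'A /= !dotDl !dotZl; nra.
apply/setP => j; rewrite [LHS]inE [RHS]inE; case jS: (tg j \in S); rewrite ?andbF ?andbT //.
have [jA|jA] := boolP (j \in max_vertices l); last first.
  have [j0 tj0 j0A] := exists_max_vertex l (tg j).
  apply/negP => /max_verticesP /(_ j0 tj0); rewrite leNgt.
  by rewrite gapE.
apply/max_verticesP => j' tj'; have [j'A|j'A] := boolP (j' \in max_vertices l).
  rewrite !dotDl !dotZl (ties j' j) ?lerD2r //; try by rewrite inE ?jA ?j'A ?tj' jS.
  by move/max_verticesP: jA; apply.
by rewrite ltW // gapE.
Qed.

(** A vertex maximal at both ends stays maximal in between. Any other loses strictly, at both ends,
    to one and the same maximal vertex [j0], hence also in between. *)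
Lemma pattern_convex S l l' t : pattern S l = pattern S l' -> 0 <= t <= 1 ->
  pattern S (l + t *: (l' - l)) = pattern S l.
Proof.
move=> eqX /andP[t0 t1].
apply/setP => j; rewrite [LHS]inE [RHS]inE; case jS: (tg j \in S); rewrite ?andbF ?andbT //.
have memE j' : tg j' \in S -> (j' \in max_vertices l') = (j' \in max_vertices l).
  by move=> j'S; have /setP /(_ j') := eqX; rewrite inE [RHS]inE j'S !andbT.
have [jA|jA] := boolP (j \in max_vertices l); last first.
  have [j0 tj0 j0A] := exists_max_vertex l (tg j).
  have lt1 l1 : j \notin max_vertices l1 -> j0 \in max_vertices l1 ->
      dot l1 (w j) < dot l1 (w j0).
    move=> nmax max0; rewrite ltNge; apply: contra nmax => le0.
    apply/max_verticesP => j' tj'; apply: le_trans le0.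
    by move/max_verticesP: max0; apply; rewrite tj0.
  have := lt1 _ jA j0A; have := lt1 l'; rewrite !memE ?tj0 ?jS // => /(_ jA j0A) H1 H2.
  apply/negP => /max_verticesP /(_ j0 tj0); rewrite leNgt => /negP; apply.
  rewrite !dotDl !dotZl !dotBl.
  rewrite -subr_ge0 in t1; rewrite -subr_gt0 in H1; rewrite -subr_gt0 in H2.
  have [->|tn0] := eqVneq t 0; first by rewrite !mul0r !addr0 -subr_gt0.
  have t_gt0 : 0 < t by rewrite lt_neqAle eq_sym tn0.
  have := mulr_gt0 t_gt0 H1; have := mulr_ge0 t1 (ltW H2); lra.
apply/max_verticesP => j' tj'; have := jA; rewrite -memE ?jS //.
move/max_verticesP => /(_ _ tj') H1; move/max_verticesP: jA => /(_ _ tj') H2.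
rewrite !dotDl !dotZl !dotBl.
rewrite -subr_ge0 in t1; rewrite -subr_ge0 in H1; rewrite -subr_ge0 in H2.
have := mulr_ge0 t0 H1; have := mulr_ge0 t1 H2; lra.
Qed.

End Patterns.

(** * Upper directions and dimensions of cones *)

Lemma card_fset_set_image (X : finType) (T : choiceType) (E : {set X}) (g : X -> T)
    (A : set T) : {in E &, injective g} ->
  (forall F, A F <-> exists2 x, x \in E & g x = F) -> #|` fset_set A| = #|E|.
Proof.
move=> injg AE; have -> : A = [set g x | x in [set` E]]%classic.
  by apply/predeqP => F; rewrite AE.
rewrite fset_set_image; last exact: finite_finset.
have -> : fset_set [set` E] = [fset x in E]%fset.
  apply/fsetP => x; rewrite in_fset_set; last exact: finite_finset.
  by apply/idP/idP; rewrite !inE.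
rewrite card_in_imfset /=; first by rewrite -card_finset.
by move=> x y; rewrite !inE => xE yE; apply: injg.
Qed.

Lemma maximizersZ (R : realType) (n : nat) (F : set 'rV[R]_n.+1) (a : R) l :
  0 < a -> maximizers (a *: l) F = maximizers l F.
Proof.
move=> a0; apply/predeqP => x; split=> -[Fx maxx]; split=> // y /maxx.
  by rewrite !dotZl ler_pM2l.
by rewrite !dotZl ler_pM2l.
Qed.

Lemma upper_neq0 (R : realType) (n : nat) (l : 'rV[R]_n.+1) : 0 < l 0 ord_max -> l != 0.
Proof. by apply: contraTneq => ->; rewrite mxE ltxx. Qed.

Definition unit_dir (R : realType) (n : nat) (l : 'rV[R]_n.+1) :=
  (Num.sqrt (dot l l))^-1 *: l.

Section UnitDirection.
Context {R : realType} {n : nat}.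
Variable l : 'rV[R]_n.+1.
Hypothesis l0 : 0 < l 0 ord_max.

Lemma inv_norm_gt0 : 0 < (Num.sqrt (dot l l))^-1.
Proof. by rewrite invr_gt0 sqrtr_gt0 dot_gt0 // upper_neq0. Qed.

Lemma unit_dir_sphere : sphere (unit_dir l).
Proof.
have ll : 0 < dot l l by rewrite dot_gt0 // upper_neq0.
rewrite /sphere /= /unit_dir dotZl dotZr mulrA -invfM -expr2 sqr_sqrtr ?ltW //.
by rewrite mulVf ?gt_eqF.
Qed.

Lemma unit_dir_upper : 0 < unit_dir l 0 ord_max.
Proof. by rewrite mxE mulr_gt0 // inv_norm_gt0. Qed.

Lemma maximizers_unit_dir F : maximizers (unit_dir l) F = maximizers l F.
Proof. by rewrite maximizersZ // inv_norm_gt0. Qed.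

End UnitDirection.

(** Rescaling a direction keeps its maximizers, so the sphere may be traded for an open half-space,
    where convexity makes sense. *)
Lemma upper_partP (R : realType) (n : nat) (F G : set 'rV[R]_n.+1) :
  upper_part G F <-> exists l : 'rV[R]_n.+1, 0 < l 0 ord_max /\ maximizers l G = F.
Proof.
split=> [[_ [l [[_ maxl] l0]]]|[l [l0 maxl]]]; first by exists l.
split; first by exists l.
exists (unit_dir l); split; last exact: unit_dir_upper.
by split; [exact: unit_dir_sphere | rewrite maximizers_unit_dir].
Qed.

Lemma lin_dim_gt0 (R : realType) (d : nat) (A : set 'rV[R]_d) l :
  (0 < d)%N -> A l -> l != 0 -> (0 < lin_dim A)%N.
Proof.
case: d A l => // d A l _ Al nz.
have rank1 : `[< exists M : 'M[R]_(1, d.+1), (forall i, A (row i M)) /\ row_free M >].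
  apply/asboolP; exists l; split=> [i|]; first by rewrite ord1 row_id.
  by rewrite /row_free rank_rV nz.
exact: (@leq_bigmax_cond _ _ _ (Ordinal (isT : 1 < d.+2)%N) rank1).
Qed.

(** A family of [d] independent vectors of [A] would be an invertible matrix that annihilates
    [z]. *)
Lemma lin_dim_lt (R : realType) (d : nat) (A : set 'rV[R]_d) (z : 'rV[R]_d) :
  z != 0 -> (forall l, A l -> dot l z = 0) -> (lin_dim A < d)%N.
Proof.
case: d A z => [A z|d A z nz orth]; first by rewrite thinmx0 eqxx.
rewrite ltnS; apply/bigmax_leqP => k /asboolP [M [AM freeM]].
rewrite -ltnS ltn_neqAle -ltnS ltn_ord andbT; apply: contra nz => /eqP kd.
move: M AM freeM; rewrite kd => M AM.
rewrite row_free_unit => unitM.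
have Mz : M *m z^T = 0.
  apply/matrixP => i j; rewrite !mxE ord1 -[RHS](orth _ (AM i)).
  by apply: eq_bigr => t _; rewrite !mxE.
by rewrite -(trmxK z) -[z^T](mulKmx unitM) Mz mulmx0 trmx0.
Qed.

(** * Counting upper faces with weights *)

Section Counting.
Context {R : realType} {n m : nat} {J : finType}.
Local Notation V := 'rV[R]_n.+1.
Variables (P : 'I_m -> set V) (tg : J -> 'I_m) (w : J -> V).
Hypothesis vertP : forall j, P (tg j) (w j).
Hypothesis exmaxP : forall i l, exists j, tg j = i /\ maximizers l (P i) (w j).
Hypothesis subP : forall i l l',
  (forall j, tg j = i -> maximizers l (P i) (w j) -> maximizers l' (P i) (w j)) ->
  forall x, maximizers l (P i) x -> maximizers l' (P i) x.
Hypothesis pointP : forall i l p,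
  (forall j, tg j = i -> maximizers l (P i) (w j) -> w j = p) ->
  forall x, maximizers l (P i) x -> x = p.
Local Notation A := (max_vertices P tg w).
Local Notation pat := (pattern P tg w).
Local Notation nontriv := (nontrivial tg w).
Local Notation cor := (core tg w).
Hypothesis boundP : forall l : V, 0 < l 0 ord_max -> (#|nontriv (A l)| <= n)%N.
Variable s : nat.

Definition upper_patterns (S : {set 'I_m}) : {set {set J}} :=
  [set X | `[< exists l : V, [/\ 0 < l 0 ord_max, pat S l = X &
     aff_dim (maximizers l (minkowski_sum P S)) = s] >]].

(** Patterns and faces over [S] determine each other, which turns the count into the size of a
    finite set. *)
Lemma f_upper_patterns S : f_upper s (minkowski_sum P S) = #|upper_patterns S|.
Proof.
have /choice [dir hdir] : forall X : {set J}, exists l : V, X \in upper_patterns S ->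
    [/\ 0 < l 0 ord_max, pat S l = X & aff_dim (maximizers l (minkowski_sum P S)) = s].
  move=> X; have [|] := boolP (X \in upper_patterns S); last by exists 0.
  by rewrite inE => /asboolP [l hl]; exists l.
have eqmax := maximizers_eq_pattern exmaxP subP S.
apply: (card_fset_set_image (g := fun X => maximizers (dir X) (minkowski_sum P S))).
  move=> X Y XE YE /= eqF; have [_ <- _] := hdir _ XE; have [_ <- _] := hdir _ YE.
  exact/eqmax.
move=> F; split=> [[/upper_partP [l [l0 maxl]] dimF]|[X /hdir [l0 _ dimX] <-]].
  have XE : pat S l \in upper_patterns S.
    by rewrite inE; apply/asboolP; exists l; rewrite maxl.
  by exists (pat S l) => //; rewrite -maxl; apply/eqmax; case: (hdir _ XE).
by split=> //; apply/upper_partP; exists (dir X).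
Qed.

Lemma pat_of_subset (S T : {set 'I_m}) l : T \subset S ->
  pat T l = [set j in pat S l | tg j \in T].
Proof.
move=> subT; apply/setP => j; rewrite !inE.
by have [/(fintype.subsetP subT) ->|] := boolP (tg j \in T); rewrite ?andbT ?andbF.
Qed.

(* The directions [l] whose pattern over [T] is [Y] form a relatively open cone;
   the cells of the sums [P_S] whose nontrivial summands are those in [T], with
   faces given by [Y], are relatively open in it, because the other summands
   only contribute vertices. *)
Lemma sum_core_fibre (coef : {set 'I_m} -> int) (Y : {set J}) :
  (forall B N : {set 'I_m}, (#|N| <= n)%N -> \sum_(S | N :&: S == B) coef S = 0) ->
  \sum_(SX | (SX.2 \in upper_patterns SX.1) && (cor SX.2 == Y)) coef SX.1 = 0.
Proof.
move=> zero_coef.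
pose I (SX : {set 'I_m} * {set J}) :=
  (SX.2 \in upper_patterns SX.1) && (cor SX.2 == Y).
(* Any pair in the fibre fixes the set [T] and shows that [Y] is a pattern over it. *)
have [[S0 X0] I0|noI] := pickP I; last first.
  by rewrite big_pred0.
have /andP[+ /eqP coreX0] := I0; rewrite inE => /asboolP [l0 [l0_gt0 patX0 dim0]].
rewrite /= in coreX0 patX0 dim0.
pose T := nontriv (A l0) :&: S0.
have patT : pat T l0 = Y by rewrite -coreX0 -patX0 core_pattern.
have coreE S l : cor (pat S l) = Y -> nontriv (A l) :&: S = T.
  rewrite core_pattern -patT => /(congr1 (fun X : {set J} => tg @: X)).
  by rewrite /= !(tags_pattern exmaxP).
pose D : set V := fun l => 0 < l 0 ord_max /\ pat T l = Y.
(* The dimension is left out of the cells: equal cores force it to be that of the chosen pair. *)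
pose Q (SX : {set 'I_m} * {set J}) : set V := fun l =>
  [/\ 0 < l 0 ord_max, pat SX.1 l = SX.2 & cor SX.2 = Y].
have QT SX l : Q SX l -> T \subset SX.1.
  case=> _ <- /coreE <-; exact: finset.subsetIr.
have subQ SX l : Q SX l -> D l.
  move=> [l_gt0 patX coreX]; split=> //.
  by rewrite -{1}(coreE SX.1 l) ?patX // -core_pattern patX.
(* All directions in [D] have the same ties over [T], so a displacement between two of them
   preserves these ties. *)
have tiesT l l' j j' : D l -> D l' -> j \in pat T l -> j' \in pat T l -> tg j = tg j' ->
    dot l' (w j) = dot l' (w j').
  move=> [_ patl] [_ patl']; rewrite patl -patl' !inE => /andP[jA _] /andP[j'A _] tjj.
  move: jA j'A => /asboolP jA /asboolP j'A; rewrite -tjj in j'A.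
  by apply/le_anti/andP; split;
    [apply: (proj2 j'A); case: jA | apply: (proj2 jA); case: j'A].
rewrite -[RHS](@sum_nonempty_convex _ _ _ D Q (fun SX => coef SX.1)).
- apply: eq_bigl => -[S X]; rewrite /I /=; apply/andP/asboolP.
    move=> []; rewrite inE => /asboolP [l [l_gt0 patX _]] /eqP coreX.
    by exists l.
  move=> [l [/= l_gt0 patX coreX]]; split; last exact/eqP.
  rewrite inE; apply/asboolP; exists l; split=> //.
  rewrite -dim0; apply: (aff_dim_eq_core exmaxP subP pointP).
  by rewrite patX coreX patX0 coreX0.
- move=> l l' Dl Dl'.
  have [|e e0 [pos patl]] :=
      pattern_perturbation vertP exmaxP (S := T) (u := l - l') (proj1 Dl).
    move=> j j' jT j'T tjj; rewrite !dotBl (tiesT l l' j j') //.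
    by rewrite (tiesT l l j j').
  by exists e => //; split=> //; rewrite patl; case: Dl.
- by move=> SX l /subQ.
- move=> [S X] l l' QSX Dl'; have [l_gt0 /= patX coreX] := QSX.
  have Dl := subQ _ _ QSX; have subT := QT _ _ QSX.
  have [|e e0 [pos patl]] :=
      pattern_perturbation vertP exmaxP (S := S) (u := l' - l) l_gt0.
    move=> j j' jS j'S tjj; have [jT|jT] := boolP (tg j \in T).
      have mem i : i \in pat S l -> tg i \in T -> i \in pat T l.
        by move=> iS iT; rewrite (pat_of_subset l subT) inE iS.
      have jT' := mem _ jS jT; have j'T' : j' \in pat T l by rewrite mem -?tjj.
      by rewrite !dotBl (tiesT l l' j j') // (tiesT l l j j').
    (* Outside [T] the face of the summand is a single point, so the tied vertices coincide. *)
    suff -> : w j = w j' by [].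
    apply/eqP; apply: contraR jT => neq; rewrite -(coreE S l) ?patX //.
    rewrite -nontrivial_pattern patX; apply/nontrivialP; exists j, j'.
    by rewrite -patX.
  by exists e => //; split=> //=; rewrite patl.
- move=> [S X] l l' t [/= l_gt0 patX coreX] [/= l'_gt0 patX' _] t01; split=> //=.
    rewrite !mxE; have /andP[t0 t1] := t01.
    have [->|tn1] := eqVneq t 1; first by rewrite mul1r addrC subrK.
    have lt_t1 : 0 < 1 - t by rewrite subr_gt0 lt_neqAle tn1.
    by have := mulr_gt0 lt_t1 l_gt0; have := mulr_ge0 t0 (ltW l'_gt0); lra.
  by rewrite (pattern_convex vertP exmaxP) // patX.
move=> l.
have [[S1 X1] /asboolP Q1|noQ] := pickP (fun SX => `[< Q SX l >]); last first.
  by rewrite big_pred0.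
have Dl := subQ _ _ Q1; have [l_gt0 _ _] := Q1.
(* The cells through [l] are given by the pairs of [S] and [pat S l], one for each [S] that meets
   the nontrivial set of [l] in [T]. *)
rewrite -[RHS](zero_coef T _ (boundP l_gt0)).
rewrite (reindex_onto (fun S => (S, pat S l)) fst) /=; last first.
  by move=> [S X] /asboolP [_ /= <-].
apply: eq_bigl => S; rewrite eqxx andbT; apply/asboolP/eqP => [[_ _ /coreE]//|NS].
by split=> //=; rewrite core_pattern NS; case: Dl.
Qed.

(** The sum runs over pairs of a set [S] and an upper pattern over it; grouped by core, each group
    cancels. *)
Lemma sum_coef_f_upper (coef : {set 'I_m} -> int) :
  (forall B N : {set 'I_m}, (#|N| <= n)%N -> \sum_(S | N :&: S == B) coef S = 0) ->
  \sum_S coef S * (f_upper s (minkowski_sum P S))%:Z = 0.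
Proof.
move=> zero_coef.
have -> : \sum_S coef S * (f_upper s (minkowski_sum P S))%:Z =
    \sum_(SX | SX.2 \in upper_patterns SX.1) coef SX.1.
  rewrite -(pair_big_dep predT (fun S X => X \in upper_patterns S) (fun S _ => coef S)) /=.
  by apply: eq_bigr => S _; rewrite sumr_const f_upper_patterns -mulr_natr natz.
apply: (sum_by_key (key := fun SX => cor SX.2)) => Y.
exact: sum_core_fibre.
Qed.

End Counting.

(** * General orientation and the face count *)

(** Each nontrivial summand has a cell of codimension at least 1. These cells meet in the unit
    vector along [l], so their intersection has codimension at most [n], and general orientation
    bounds the sum of their codimensions by [n]. *)
Lemma card_nontrivial_le (R : realType) (n m : nat) (J : finType)
    (P : 'I_m -> set 'rV[R]_n.+1) (tg : J -> 'I_m) (w : J -> 'rV[R]_n.+1)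
    (l : 'rV[R]_n.+1) :
  general_orientation P -> 0 < l 0 ord_max ->
  (#|nontrivial tg w (max_vertices P tg w l)| <= n)%N.
Proof.
move=> [_ genP] l0; set N := nontrivial _ _ _.
pose C i := cell (maximizers l (P i)) (P i).
have Cl i : C i (unit_dir l).
  by split; [exact: unit_dir_sphere | rewrite maximizers_unit_dir].
have ul0 : unit_dir l != 0 by apply/upper_neq0/unit_dir_upper.
have codimC i : i \in N -> (1 <= sph_codim (C i))%N.
  move=> /nontrivialP [j [j' []]]; rewrite inE => /asboolP maxj.
  rewrite inE => /asboolP maxj' tj tj' neq.
  rewrite tj in maxj; rewrite tj' in maxj'.
  have lt_n : (lin_dim (C i) < n.+1)%N.
    (* Both vertices are maximal for every direction of the cell, which is thus orthogonal to their
       difference. *)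
    apply: (@lin_dim_lt _ _ _ (w j - w j')); first by rewrite subr_eq0.
    move=> u [_ maxu]; rewrite dotBr; apply/eqP; rewrite subr_eq0 eq_le.
    move: maxj maxj'; rewrite -maxu => -[Pj maxj] [Pj' maxj'].
    by rewrite (maxj' _ Pj) (maxj _ Pj').
  (* Positivity of [lin_dim] keeps the predecessor in [sph_dim] from truncating, so the codimension
     is indeed positive. *)
  have := lin_dim_gt0 (ltn0Sn n) (Cl i) ul0; rewrite /sph_codim /sph_dim; lia.
have [||] := genP N C.
  by move=> i _; exists (maximizers l (P i)); split=> //; exists l.
  move=> K0; have : (set0 : set 'rV[R]_n.+1) (unit_dir l); last by [].
  by rewrite -K0; split; [exact: unit_dir_sphere | move=> i _; apply: Cl].
set K := (_ `&` _)%classic => le_codim.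
have : (\sum_(i in N) 1 <= \sum_(i in N) sph_codim (C i))%N by apply: leq_sum.
rewrite sum1_card; move: le_codim; rewrite /sph_codim; lia.
Qed.

Theorem theorem4p10 (R : realType) (n m : nat)
    (P : 'I_m -> set 'rV[R]_n.+1)
    (polyP : forall i, polytope (P i))
    (posP : forall i, (0 < aff_dim (P i))%N)
    (genP : general_orientation P)
    (le_n_m : (n + 1 <= m)%N)
    (s : nat) (le_s_n : (s <= n)%N) :
  (f_upper s (minkowski_sum P [set: 'I_m]))%:Z =
  \sum_(0 <= j < n.+1)
    (-1) ^+ (n - j) * ('C(m - 1 - j, n - j))%:Z *
    \sum_(S : {set 'I_m} | #|S| == j) (f_upper s (minkowski_sum P S))%:Z.
Proof.
have /choice [kv PE] : forall i, exists kv : {k : nat & 'I_k.+1 -> 'rV[R]_n.+1},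
    P i = conv_hull (tagged kv).
  by move=> i; have [k [v Pv]] := polyP i; exists (existT _ k v).
(* The generators of all the polytopes are collected in one finite type, so that faces of every
   partial sum become subsets of it. *)
pose J : finType := {i : 'I_m & 'I_(tag (kv i)).+1}.
pose tg (j : J) := tag j.
pose w (j : J) := tagged (kv (tag j)) (tagged j).
pose vert i (j : 'I_(tag (kv i)).+1) : J := existT _ i j.
have zero : \sum_S face_coef n S * (f_upper s (minkowski_sum P S))%:Z = 0.
  apply: (@sum_coef_f_upper R n m J P tg w).
  - by move=> [i j]; rewrite PE; apply: conv_hull_vertex.
  - move=> i l; have [j maxj] := exists_maximal_vertex (tagged (kv i)) l.
    by exists (vert i j); rewrite PE.
  - move=> i l l' sub; rewrite PE; apply: maximizers_conv_hull_sub => j.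
    by have := sub (vert i j) erefl; rewrite PE.
  - move=> i l p eqp x; rewrite PE; apply: maximizers_conv_hull_point => j.
    by have := eqp (vert i j) erefl; rewrite PE.
  - by move=> l; apply: card_nontrivial_le.
  - by move=> B N; apply: sum_face_coef; rewrite -addn1.
(* The difference of the two sides is the vanishing sum [zero], expanded by the definition of
   [face_coef]. *)
apply/eqP; rewrite -subr_eq0 -[X in _ == X]zero; apply/eqP.
under [RHS]eq_bigr do rewrite mulrBl mulr_suml.
rewrite sumrB exchange_big /=; congr (_ - _).
  rewrite (bigD1 [set: 'I_m]) //= eqxx mul1r big1 ?addr0 // => S /negPf ->.
  by rewrite mul0r.
apply: eq_bigr => j _; rewrite mulr_sumr big_mkcond; apply: eq_bigr => S _.
by case: (#|S| == j); rewrite ?mulr1 ?mulr0 ?mul0r.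
Qed.
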